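(* Let $\mathsf{C}$ be a whiskered groupoid and let $a:x\to y$, $b:u\to v$, $c:y\to z$, $d:v\to w$ be arrows of $\mathsf{C}$. Then $$[ac,b]=[a,b]^{c.v}\,[c,b],\qquad [a,bd]=[a,d]\,[a,b]^{y.d}.$$
   Context: Composition is written in diagrammatic order: $ab$ or $a\circ b:x\to z$ for $a:x\to y$, $b:y\to z$. In a groupoid $g^h=h^{-1}gh$. A whiskered category is a category $\mathsf{C}$ (objects $\mathsf{C}_0$, arrows $\mathsf{C}_1$) with: a monoid structure on $\mathsf{C}_0$, written $xy$ with identity $1$; and, for each object $x$ and arrow $a:u\to v$, arrows $x.a:xu\to xv$ and $a.x:ux\to vx$, such that $1.a=a$, $(xy).a=x.(y.a)$, $x.(a\circ b)=(x.a)\circ(x.b)$, $x.1_y=1_{xy}$; analogously $a.1=a$, $a.(xy)=(a.x).y$, $(a\circ b).x=(a.x)\circ(b.x)$, $1_y.x=1_{yx}$; and $x.(a.y)=(x.a).y$. A whiskered groupoid is a whiskered category which is a groupoid. The commutator of $a:x\to y$ and $b:u\to v$ in a whiskered groupoid is $$[a,b]=(a.v)^{-1}(x.b)^{-1}(a.u)(y.b)\in\mathsf{C}(yv,yv).$$ *)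

(* Defs.v *)
From HB Require Import structures.
From mathcomp Require Import all_boot.

Set Implicit Arguments.
Unset Strict Implicit.
Unset Printing Implicit Defensive.

Declare Scope arrow_scope.
Delimit Scope arrow_scope with arr.
Local Open Scope group_scope.
Local Open Scope arrow_scope.

HB.mixin Record IsQuiver C := { hom : C -> C -> Type }.

#[short(type="quiver")]
HB.structure Definition Quiver := { C of IsQuiver C }.

Bind Scope arrow_scope with hom.

(* The total set of arrows. Two arrows are compared in it when their sources
   and targets are only provably equal, as for 1 . a = a, where
   1 . a : 1 u -> 1 v and a : u -> v; equality there includes equality of the
   sources and of the targets. *)
Definition arrows (C : quiver) : Type := {xy : C * C & hom xy.1 xy.2}.

Definition arrow (C : quiver) (x y : C) (a : hom x y) : arrows C :=
  existT (fun xy : C * C => hom xy.1 xy.2) (x, y) a.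

(* Composition is in diagrammatic order. *)
HB.mixin Record Quiver_isCategory C of Quiver C := {
  idarr : forall x : C, hom x x;
  compa : forall x y z : C, hom x y -> hom y z -> hom x z;
  comp1a : forall (x y : C) (a : hom x y), compa _ _ _ (idarr x) a = a;
  compa1 : forall (x y : C) (a : hom x y), compa _ _ _ a (idarr y) = a;
  compaA : forall (x y z t : C) (a : hom x y) (b : hom y z) (c : hom z t),
    compa _ _ _ a (compa _ _ _ b c) = compa _ _ _ (compa _ _ _ a b) c
}.

#[short(type="category")]
HB.structure Definition Category := { C of Quiver_isCategory C & Quiver C }.

Arguments compa {C x y z} : rename.
Notation "a \; b" := (compa a b) : arrow_scope.

HB.mixin Record Category_isGroupoid C of Category C := {
  inva : forall x y : C, hom x y -> hom y x;
  compaV : forall (x y : C) (a : hom x y), a \; inva _ _ a = idarr x;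
  compVa : forall (x y : C) (a : hom x y), inva _ _ a \; a = idarr y
}.

#[short(type="groupoid")]
HB.structure Definition Groupoid := { C of Category_isGroupoid C & Category C }.

Arguments inva {C x y} : rename.
Notation "a ^-1" := (inva a) : arrow_scope.

Definition conja (C : groupoid) (x y : C) (g : hom x x) (h : hom x y) :
  hom y y := h^-1 \; g \; h.
Notation "g ^ h" := (conja g h) : arrow_scope.

(* The monoid axioms for the product and unit of a pointed magma; they are not
   taken from monoidType because that would also require C to be a
   choiceType. *)
HB.mixin Record BaseUMagma_isObjMonoid C of BaseUMagma C := {
  objmulA : associative (@mul C);
  objmul1 : left_id 1%g (@mul C);
  objmulr1 : right_id 1%g (@mul C)
}.

(* lwhisk x a is x . a and rwhisk a x is a . x *)
HB.mixin Record Category_isWhiskered C of Category C & BaseUMagma C := {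
  lwhisk : forall (x u v : C), hom u v -> hom (x * u)%g (x * v)%g;
  rwhisk : forall (u v : C), hom u v -> forall x : C, hom (u * x)%g (v * x)%g;
  lwhisk1 : forall (u v : C) (a : hom u v), arrow (lwhisk 1%g _ _ a) = arrow a;
  lwhiskM : forall (x y u v : C) (a : hom u v),
    arrow (lwhisk (x * y)%g _ _ a) = arrow (lwhisk x _ _ (lwhisk y _ _ a));
  lwhisk_comp : forall (x u v w : C) (a : hom u v) (b : hom v w),
    lwhisk x _ _ (a \; b) = lwhisk x _ _ a \; lwhisk x _ _ b;
  lwhisk_id : forall x y : C, lwhisk x _ _ (idarr y) = idarr (x * y)%g;
  rwhisk1 : forall (u v : C) (a : hom u v), arrow (rwhisk _ _ a 1%g) = arrow a;
  rwhiskM : forall (x y u v : C) (a : hom u v),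
    arrow (rwhisk _ _ a (x * y)%g) = arrow (rwhisk _ _ (rwhisk _ _ a x) y);
  rwhisk_comp : forall (x u v w : C) (a : hom u v) (b : hom v w),
    rwhisk _ _ (a \; b) x = rwhisk _ _ a x \; rwhisk _ _ b x;
  rwhisk_id : forall x y : C, rwhisk _ _ (idarr y) x = idarr (y * x)%g;
  lrwhisk : forall (x y u v : C) (a : hom u v),
    arrow (lwhisk x _ _ (rwhisk _ _ a y)) =
    arrow (rwhisk _ _ (lwhisk x _ _ a) y)
}.

#[short(type="whiskeredCategory")]
HB.structure Definition WhiskeredCategory :=
  { C of Category C & BaseUMagma C & BaseUMagma_isObjMonoid C &
    Category_isWhiskered C }.

#[short(type="whiskeredGroupoid")]
HB.structure Definition WhiskeredGroupoid :=
  { C of WhiskeredCategory C & Groupoid C }.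

Arguments lwhisk {C} x {u v} a : rename.
Arguments rwhisk {C u v} a x : rename.

Definition commutator (C : whiskeredGroupoid) (x y u v : C)
    (a : hom x y) (b : hom u v) : hom (y * v)%g (y * v)%g :=
  (rwhisk a v)^-1 \; (lwhisk x b)^-1 \; rwhisk a u \; lwhisk y b.

(* Main.v *)
Require Import Defs.
From mathcomp Require Import all_boot.

Local Open Scope arrow_scope.

(** Both identities hold by free cancellation in the groupoid: whiskering by a
    fixed object is functorial, so the commutator of a composite expands into
    a word in whiskered arrows and their inverses, and the right-hand side
    is the same word with one extra cancelling stretch in the middle, where
    the end of one commutator meets the beginning of the other. That stretch
    is [(y.b)(c.v)] followed by [(c.v)^-1 (y.b)^-1] in the first identity, and
    [(a.v)(y.d)] followed by [(y.d)^-1 (a.v)^-1] in the second. *)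

Lemma compaK (C : groupoid) (x y z : C) (a : hom x y) (b : hom y z) :
  (a \; b) \; b^-1 = a.
Proof. by rewrite -compaA compaV compa1. Qed.

Lemma inva_comp (C : groupoid) (x y z : C) (a : hom x y) (b : hom y z) :
  (a \; b)^-1 = b^-1 \; a^-1.
Proof.
have e : (a \; b) \; (b^-1 \; a^-1) = idarr x by rewrite compaA compaK compaV.
by rewrite -[LHS]compa1 -e compaA compVa comp1a.
Qed.

Theorem proposition3p2 (C : whiskeredGroupoid) (x y z u v w : C)
    (a : hom x y) (b : hom u v) (c : hom y z) (d : hom v w) :
  commutator (a \; c) b = commutator a b ^ rwhisk c v \; commutator c b /\
  commutator a (b \; d) = commutator a d \; commutator a b ^ lwhisk y d.
Proof.
rewrite /commutator /conja !rwhisk_comp !lwhisk_comp !inva_comp.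
by split; rewrite !compaA !compaK.
Qed.
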